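(* Let $1\leq p<2$. Let $\omega$ be a continuous non-decreasing function on $[0,+\infty)$ with $\omega(0)=0$, and let $\varphi$ be a real function on $\mathbb T$. Suppose that $\varphi$ is non-constant and $\varphi\in C^{1,\omega}(\mathbb T)$. Then there is a constant $c=c(p,\varphi)>0$, independent of $\lambda$, such that $$\|e^{i\lambda\varphi}\|_{A_p(\mathbb T)}\geq c\,|\lambda|^{1/p}\,\chi^{-1}(1/|\lambda|),\qquad \lambda\in\mathbb R,\quad |\lambda|\geq 1,$$ where $\chi^{-1}$ is the function inverse to $\chi(\delta)=\delta\,\omega(\delta)$.
   Context: $\mathbb T=\mathbb R/2\pi\mathbb Z$; functions on $\mathbb T$ are identified with $2\pi$-periodic functions on $\mathbb R$. Fourier coefficients: $\widehat f(k)=\frac1{2\pi}\int_0^{2\pi}f(t)e^{-ikt}\,dt$, $k\in\mathbb Z$. $A_1(\mathbb T)=A(\mathbb T)$ is the space of continuous functions $f$ on $\mathbb T$ with $\{\widehat f(k)\}\in l^1$; for $1<p\le 2$, $A_p(\mathbb T)$ is the space of integrable functions $f$ on $\mathbb T$ with $\{\widehat f(k)\}\in l^p$. The norm is $\|f\|_{A_p(\mathbb T)}=\big(\sum_{k\in\mathbb Z}|\widehat f(k)|^p\big)^{1/p}$. For an interval $I\subseteq\mathbb R$ and a function $g$ on $I$, $\omega(I,g,\delta)=\sup\{|g(t_1)-g(t_2)|: t_1,t_2\in I,\ |t_1-t_2|\le\delta\}$. $\mathrm{Lip}_\omega(I)$ is the class of functions $g$ on $I$ with $\omega(I,g,\delta)=O(\omega(\delta))$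 as $\delta\to+0$. $C^{1,\omega}(I)$ is the class of differentiable functions $g$ on $I$ with $g'\in\mathrm{Lip}_\omega(I)$, and $C^{1,\omega}(\mathbb T)$ is the class of $2\pi$-periodic functions belonging to $C^{1,\omega}(\mathbb R)$. *)

(* Defs.v *)
From HB Require Import structures.
From mathcomp Require Import all_boot all_order all_algebra.
From mathcomp Require Import all_classical all_reals all_analysis.
From mathcomp Require Import complex.

Set Implicit Arguments.
Unset Strict Implicit.
Unset Printing Implicit Defensive.

Import Order.TTheory GRing.Theory Num.Theory.
Import numFieldNormedType.Exports.

Local Open Scope classical_set_scope.
Local Open Scope ring_scope.
Local Open Scope complex_scope.

Section defs.
Context {R : realType}.
Implicit Types (I : set R) (g phi omega : R -> R) (f : R -> R[i]).

Definition expi (t : R) : R[i] := cos t +i* sin t.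

(* Componentwise Lebesgue integral over [0, 2 * pi]. *)
Definition period_integral f : R[i] :=
  (\int[lebesgue_measure]_(t in `[0%R, 2 * pi]) complex.Re (f t)) +i*
  (\int[lebesgue_measure]_(t in `[0%R, 2 * pi]) complex.Im (f t)).

Definition fourier_coef f (k : int) : R[i] :=
  ((2 * pi)^-1)%:C * period_integral (fun t => f t * expi (- (k%:~R * t))).

(* Extended-real valued: +oo when the Fourier coefficients are not in l^p, so
   that no summability is presupposed.  normc is the real-valued modulus. *)
Definition Ap_norm (p : R) f : \bar R :=
  ((\esum_(k in [set: int]) (Normc.normc (fourier_coef f k) `^ p)%:E)
     `^ p^-1)%E.

(* A supremum in \bar R: +oo if the set of oscillations is unbounded (the
   real-valued sup would be 0 there). *)
Definition modulus_of_continuity I g (delta : R) : \bar R :=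
  ereal_sup [set e : \bar R | exists t1 t2 : R,
    [/\ I t1, I t2, `|t1 - t2| <= delta & e = `|g t1 - g t2|%:E]].

Definition Lip_omega omega I g : Prop :=
  exists C : R, \forall delta \near 0^'+,
    (modulus_of_continuity I g delta <= (C * omega delta)%:E)%E.

Definition C1omega_line omega g : Prop :=
  (forall t, derivable g t 1) /\ Lip_omega omega setT (g^`())%classic.

Definition C1omega_torus omega phi : Prop :=
  periodic phi (2 * pi) /\ C1omega_line omega phi.

Definition chi omega (delta : R) : R := delta * omega delta.

(* Inverse of chi as a function on [0, +oo[ (the default 0 is only used outside
   the image of [0, +oo[ under chi). *)
Definition chi_inv omega : R -> R :=
  'pinv_(fun=> 0) [set` `[0, +oo[] (chi omega).

End defs.

(* Main.v *)
Require Import Defs.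
From HB Require Import structures.
From mathcomp Require Import all_boot all_order all_algebra.
From mathcomp Require Import all_classical all_reals all_analysis.
From mathcomp Require Import complex ring lra.

Set Implicit Arguments.
Unset Strict Implicit.
Unset Printing Implicit Defensive.

Import Order.TTheory GRing.Theory Num.Theory.
Import numFieldNormedType.Exports.

Local Open Scope classical_set_scope.
Local Open Scope ring_scope.

(**
Write [f = expi \o g] with [g = lambda * phi].  Since [phi'] is continuous and
not constant, [g'] runs through an interval of length [|lambda| * D] with
[D > 0], so about [|lambda| * D] integers [k] are within [1] of a value [g' s].
Near such an [s], the function [f t] looks like [expi (k * t)] up to a constant
factor, and it does so on an interval of radius [h] as soon as
[|lambda| * h * omega h] is small.  The choice [h = kappa * rho] with
[rho = chi_inv omega (1 / |lambda|)] and a small constant [kappa] achieves this,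
because [rho * omega rho = 1 / |lambda|].  Hence the product of [f] with a
kernel concentrated at scale [h] around [s] has a [k]-th coefficient of
modulus at least a constant times [h].

The kernel is a power of [havercos x = (1 + cos x) / 2 = cos^2 (x / 2)],
translated by [s].  Multiplication by [havercos (t - s)] acts on Fourier
coefficients as a convolution with weights [1/4, 1/2, 1/4], up to unimodular
factors that depend on [s].  The moduli are therefore dominated by the same
convolution of moduli ([smooth]), whatever [s] is: this uniformity is essential
because [s] depends on [k] ([integral2pi_havercos_cos_phase]).  Convolution
with a probability weight does not increase an l^p norm, [p >= 1]
([esum_iter_smooth]).  So the l^p norm of the coefficients of [f] dominates that
of a sequence that is at least [h / 56] at [|lambda| * D] places, which gives
[(|lambda| * D)^(1/p) * h / 56] ([Ap_norm_ge]) and the theorem.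

Two facts make the kernel concentrate ([exists_concentration]), and both come
from the recurrence
[(2 N + 2) int havercos^(N+1) = (2 N + 1) int havercos^N]:
the integral of [havercos^N] is at least [2 pi / sqrt (4 N + 1)], and
[1 - havercos] has average [1 / (2 N + 2)] with respect to [havercos^N].
The exponent [N] of order [1 / h^2] balances them.
*)

(** * Elementary bounds for sine and cosine *)

Section mean_value.
Context {R : realType}.
Implicit Types (f : R -> R) (x y : R).

Lemma derivable_continuous f : (forall x, derivable f x 1) -> continuous f.
Proof. by move=> df x; exact/differentiable_continuous/derivable1_diffP. Qed.

Lemma mean_value f (df : R -> R) x y :
  (forall z : R, is_derive z (1 : R) f (df z)) ->
  exists2 z, Num.min x y <= z <= Num.max x y & f y - f x = df z * (y - x).
Proof.
move=> dfE; have fc : continuous f by apply: derivable_continuous.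
have [xy|/ltW yx] := leP x y.
  have [z /itvP zxy E] :=
    MVT_segment xy (fun t _ => dfE t) (continuous_subspaceT fc).
  by exists z => //; rewrite !zxy.
have [z /itvP zxy E] :=
  MVT_segment yx (fun t _ => dfE t) (continuous_subspaceT fc).
by exists z; rewrite ?zxy // -opprB E -mulrN opprB.
Qed.

Lemma cos_lip x : 1 - `|x| <= cos x.
Proof.
have [z _] := mean_value 0 x (@is_derive_cos R).
rewrite cos0 subr0 => E.
have : `|cos x - 1| <= `|x|.
  by rewrite E normrM ler_piMl// normrN ler_norml sin_geN1 sin_le1.
by rewrite ler_norml => /andP[+ _]; lra.
Qed.

Lemma sin_lin x : 0 <= x <= 1 / 2 -> x / 2 <= sin x.
Proof.
move=> /andP[x0 x1]; have [z] := mean_value 0 x (@is_derive_sin R).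
rewrite sin0 !subr0 min_l // max_r // => /andP[z0 zx] ->.
have := cos_lip z; rewrite ger0_norm//; nra.
Qed.

End mean_value.

(** * Powers of the havercosine and their integrals over a period *)

Section kernel.
Context {R : realType}.
Implicit Types (x s t a : R) (f g F : R -> R) (N : nat).

Definition havercos x : R := (1 + cos x) / 2.

Lemma havercos_ge0 x : 0 <= havercos x.
Proof. by rewrite /havercos; have := cos_geN1 x; lra. Qed.

Lemma havercos_le1 x : havercos x <= 1.
Proof. by rewrite /havercos; have := cos_le1 x; lra. Qed.

Lemma is_derive_havercos s t :
  is_derive t 1 (fun u => havercos (u - s)) (- sin (t - s) / 2).
Proof.
rewrite /havercos; apply: is_derive_eq.
rewrite /GRing.scale/= ; ring.
Qed.

Lemma havercos_gap x : 0 <= x <= 1 -> x ^+ 2 / 16 <= 1 - havercos x.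
Proof.
move=> /andP[x0 x1].
have E : cos x = 1 - 2 * sin (x / 2) ^+ 2.
  have {1}-> : x = (x / 2) *+ 2 by rewrite mulr2n; lra.
  by rewrite cos_mulr2n cos2sin2 mulr2n; ring.
have := @sin_lin R (x / 2) ltac:(lra); rewrite /havercos E; nra.
Qed.


Lemma continuous_havercosX s N : continuous (fun t => havercos (t - s) ^+ N).
Proof.
rewrite -(exprfctE (fun t => havercos (t - s))).
by apply: derivable_continuous => u; apply: derivableX;
  case: (is_derive_havercos s u).
Qed.

Lemma continuous_mul f g : continuous f -> continuous g ->
  continuous (fun t => f t * g t).
Proof. by move=> fc gc t; exact: continuousM (fc t) (gc t). Qed.

Lemma continuous_add f g : continuous f -> continuous g ->
  continuous (fun t => f t + g t).
Proof. by move=> fc gc t; exact: continuousD (fc t) (gc t). Qed.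

Lemma continuous_scale a f : continuous f -> continuous (fun t => a * f t).
Proof. by apply: continuous_mul => t; exact: cvg_cst. Qed.

Definition integral2pi (f : R -> R) : R :=
  \int[@lebesgue_measure R]_(t in `[0%R, 2 * pi]) f t.

Lemma pi2_gt0 : 0 < 2 * pi :> R.
Proof. by rewrite mulr_gt0// pi_gt0. Qed.

Lemma continuous_integrable f : continuous f ->
  (@lebesgue_measure R).-integrable `[0%R, 2 * pi] (EFin \o f).
Proof.
move=> fc; apply: continuous_compact_integrable; first exact: segment_compact.
exact: continuous_subspaceT.
Qed.

Lemma integral2piD f g : continuous f -> continuous g ->
  integral2pi (fun t => f t + g t) = integral2pi f + integral2pi g.
Proof.
by move=> fc gc; rewrite /integral2pi RintegralD//; exact: continuous_integrable.
Qed.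

Lemma integral2piZ a f : continuous f ->
  integral2pi (fun t => a * f t) = a * integral2pi f.
Proof.
by move=> fc; rewrite /integral2pi RintegralZl//; exact: continuous_integrable.
Qed.

Lemma le_integral2pi f g : continuous f -> continuous g ->
  (forall t, f t <= g t) ->
  integral2pi f <= integral2pi g.
Proof.
by move=> fc gc fg; apply: le_Rintegral => //; exact: continuous_integrable.
Qed.

Lemma integral2pi1 : integral2pi (fun=> 1) = 2 * pi.
Proof.
rewrite /integral2pi Rintegral_cst// mul1r /= lebesgue_measure_itv/=.
by rewrite lte_fin pi2_gt0 oppr0 addr0.
Qed.

Lemma integral2pi_derivative F f : continuous f ->
  (forall t : R, is_derive t (1 : R) F (f t)) ->
  F (2 * pi) = F 0 -> integral2pi f = 0.
Proof.
move=> fc dF F0.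
have Fc : continuous F by apply: derivable_continuous => t; case: (dF t).
rewrite /integral2pi /Rintegral (@continuous_FTC2 _ f F) ?pi2_gt0//.
- by rewrite F0 -EFinD subrr.
- exact: continuous_subspaceT.
- split.
  + by move=> t _; case: (dF t).
  + exact/cvg_at_right_filter/Fc.
  + exact/cvg_at_left_filter/Fc.
- by move=> t _; rewrite derive1E; case: (dF t).
Qed.

Lemma integral2pi_havercos0 s :
  integral2pi (fun t => havercos (t - s) ^+ 0) = 2 * pi.
Proof.
by rewrite -integral2pi1; congr integral2pi; apply/funext => t; rewrite expr0.
Qed.

(** The derivative of [sin x * havercos x ^+ N] is
[(2 N + 2) havercos x ^+ N.+1 - (2 N + 1) havercos x ^+ N], because
[sin x ^+ 2 = 4 * havercos x * (1 - havercos x)]. *)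
Lemma integral2pi_havercosS s N :
  (2 * N%:R + 2) * integral2pi (fun t => havercos (t - s) ^+ N.+1) =
  (2 * N%:R + 1) * integral2pi (fun t => havercos (t - s) ^+ N).
Proof.
apply/eqP; rewrite -subr_eq0 -mulNr; apply/eqP.
have vc M : continuous (fun t => havercos (t - s) ^+ M).
  exact: continuous_havercosX.
rewrite -!integral2piZ// -integral2piD; [|exact: continuous_scale..].
apply: (@integral2pi_derivative (fun t => sin (t - s) * havercos (t - s) ^+ N)).
- by apply: continuous_add; exact: continuous_scale.
- move=> t; have dv := is_derive_havercos s t.
  have ds : is_derive t 1 (fun u => sin (u - s)) (cos (t - s)).
    by apply: is_derive_eq; rewrite /GRing.scale/=; ring.
  have := is_deriveM ds (is_deriveX N dv).
  rewrite exprfctE mulrfctE => /is_derive_eq; apply.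
  rewrite /GRing.scale/=.
  have sin2 : sin (t - s) ^+ 2 = 4 * havercos (t - s) * (1 - havercos (t - s)).
    by rewrite sin2cos2 /havercos; field.
  have -> : cos (t - s) = 2 * havercos (t - s) - 1 by rewrite /havercos; field.
  case: N => [|N]; first by rewrite expr0 expr1; ring.
  rewrite /= !exprS -(natr1 N).
  move: (havercos _) (_ ^+ N) sin2 => v w E.
  transitivity
    (- (N%:R + 1) / 2 * w * sin (t - s) ^+ 2 + v * w * (2 * v - 1)).
    by field.
  by rewrite E; field.
- rewrite add0r (_ : 2 * pi - s = - s + pi *+ 2); last by rewrite mulr2n; lra.
  by rewrite /havercos sinD2pi cosD2pi.
Qed.

(** A form of [binomial (2 N) N >= 4 ^ N / sqrt (4 N + 1)].  The constant
[4 N + 1] is the one for which the induction step closes: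
[(2 N + 1)^2 (4 N + 5) >= (2 N + 2)^2 (4 N + 1)]. *)
Lemma integral2pi_havercos_ge s N :
  (2 * pi) ^+ 2 <=
  (4 * N%:R + 1) * integral2pi (fun t => havercos (t - s) ^+ N) ^+ 2.
Proof.
elim: N => [|N]; first by rewrite integral2pi_havercos0 mulr0 add0r mul1r.
have := integral2pi_havercosS s N; rewrite -(natr1 N).
have : 0 <= N%:R :> R by [].
move: N%:R (integral2pi _) (integral2pi _) => n I J n0 E IH.
apply: (le_trans IH); rewrite -(@ler_pM2l _ ((2 * n + 2) ^+ 2)); last by nra.
have -> : (2 * n + 2) ^+ 2 * ((4 * (n + 1) + 1) * J ^+ 2) =
  (4 * (n + 1) + 1) * ((2 * n + 2) * J) ^+ 2 by ring.
rewrite E exprMn; move: (I ^+ 2) (sqr_ge0 I) => K K0.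
by rewrite !mulrA ler_wpM2r//; nra.
Qed.
End kernel.

(** * Concentration of the kernel *)

Section concentration.
Context {R : realType}.
Implicit Types (x s t a h : R) (f g F : R -> R) (N : nat).

Lemma periodicz f T : periodic f T -> forall (n : int) a, f (a + T *~ n) = f a.
Proof.
move=> fT [n|n] a; first exact: periodicn.
by rewrite NegzE mulrNz -[LHS](periodicn fT n.+1) pmulrn subrK.
Qed.

Lemma period_representative T s t : 0 < T ->
  exists n : int, `|t + T *~ n - s| <= T / 2.
Proof.
move=> T0; set x := (t - s + T / 2) / T.
exists (- Num.floor x).
have xE : t = s - T / 2 + x * T by rewrite /x divfK ?gt_eqF//; ring.
have := Num.Theory.floor_le x; have := floorD1_gt x; rewrite intrD1.
rewrite mulrNz -(mulrzr T) xE ler_norml; move: (Num.floor x)%:~R => m => xm mx.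
have := ltW xm; rewrite -subr_ge0 => /(mulr_ge0 (ltW T0)).
rewrite -subr_ge0 in mx.
have := mulr_ge0 (ltW T0) mx; lra.
Qed.

Lemma integral2pi_havercos_ge0 s N :
  0 <= integral2pi (fun t => havercos (t - s) ^+ N).
Proof. by apply: Rintegral_ge0 => t _; rewrite exprn_ge0// havercos_ge0. Qed.

Lemma cos_le_of_far h x : 0 <= h -> h <= `|x| <= pi -> cos x <= cos h.
Proof.
move=> h0 /andP[hx xpi]; rewrite -(cos_norm x).
have [->//|hx'] := eqVneq h `|x|.
apply/ltW; rewrite ltr_cos ?in_itv/= ?h0 ?normr_ge0 ?(le_trans hx)//.
by rewrite lt_neqAle hx' hx.
Qed.

(** The function [F] is only known to be large near [s].  This minorant
is a trigonometric polynomial of degree one: it is at most [1 / 2]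
everywhere and at most [-1] away from [s], so that the contribution of
the tail can be computed exactly from the recurrence for [havercos] powers. *)
Lemma trig_minorant F s h : 0 < h <= 1 -> periodic F (2 * pi) ->
  (forall t, -1 <= F t) -> (forall t, `|t - s| <= h -> 1 / 2 <= F t) ->
  forall t, 1 / 2 - 3 / 2 * (1 - havercos (t - s)) / (1 - havercos h) <= F t.
Proof.
move=> /andP[h0 h1] Fper F1 Fh t.
have := period_representative s t (@pi2_gt0 R).
rewrite [2 * pi / 2]mulrC mulKf// => -[n].
have cper : periodic (fun u => havercos (u - s)) (2 * pi).
  move=> u; rewrite /havercos addrAC (_ : 2 * pi = pi *+ 2) ?cosD2pi//.
  by rewrite mulr2n mulrDl mul1r.
rewrite -(periodicz Fper n t) -(periodicz cper n t).
move: (t + _) => {}t tpi.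
have q0 : 0 < 1 - havercos h.
  by apply: lt_le_trans (havercos_gap _); [nra|rewrite ltW].
have [th|/ltW th] := leP `|t - s| h.
  apply: le_trans (Fh _ th); rewrite gerBl// !mulr_ge0// ?invr_ge0 ?(ltW q0)//.
  by rewrite subr_ge0 havercos_le1.
apply: le_trans (F1 t).
have : 1 <= (1 - havercos (t - s)) / (1 - havercos h).
  rewrite ler_pdivlMr// mul1r; have := @cos_le_of_far h (t - s) (ltW h0).
  by rewrite th tpi => /(_ isT); rewrite /havercos; lra.
by rewrite -!mulrA; lra.
Qed.

(** The mean of [1 - havercos (t - s)] for the weight [havercos (t - s) ^+ N] is
[1 / (2 N + 2)], and [1 - havercos h >= h ^+ 2 / 16]; the condition on [N]
makes the loss due to the tail at most half of the main term. *)
Lemma integral2pi_concentration F s h N : 0 < h <= 1 -> 48 <= N%:R * h ^+ 2 ->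
  continuous F -> periodic F (2 * pi) ->
  (forall t, -1 <= F t) -> (forall t, `|t - s| <= h -> 1 / 2 <= F t) ->
  integral2pi (fun t => havercos (t - s) ^+ N) / 4 <=
  integral2pi (fun t => havercos (t - s) ^+ N * F t).
Proof.
move=> h01 hN Fc Fper F1 Fh; have Fmin := trig_minorant h01 Fper F1 Fh.
have q16 : h ^+ 2 / 16 <= 1 - havercos h.
  by apply: havercos_gap; case/andP: h01 => /ltW ->.
have q0 : 0 < 1 - havercos h.
  by apply: lt_le_trans q16; rewrite divr_gt0// exprn_gt0//; case/andP: h01.
move: (1 - havercos h) q16 q0 Fmin => q q16 q0 Fmin.
have vc M : continuous (fun t => havercos (t - s) ^+ M).
  exact: continuous_havercosX.
apply: (@le_trans _ _ (integral2pi (fun t =>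
    (1 / 2 - 3 / 2 / q) * havercos (t - s) ^+ N
    + 3 / 2 / q * havercos (t - s) ^+ N.+1))); last first.
  apply: le_integral2pi.
  - by apply: continuous_add; exact: continuous_scale.
  - exact: continuous_mul.
  - move=> t; apply: le_trans (ler_wpM2l _ (Fmin t)); last first.
      by rewrite exprn_ge0// havercos_ge0.
    by rewrite exprS le_eqVlt; apply/orP; left; apply/eqP; ring.
rewrite integral2piD ?integral2piZ//; try exact: continuous_scale.
have := integral2pi_havercos_ge0 s N; have := integral2pi_havercosS s N.
move: (integral2pi _) (integral2pi _) => I J E I0.
have n0 : 0 <= N%:R :> R by [].
move: (N%:R) n0 hN E => n n0 hN E.
have -> : J = I - I / (2 * n + 2).
  have n2 : 2 * n + 2 != 0 by rewrite gt_eqF//; nra.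
  by apply: (mulfI n2); rewrite E; field.
have -> : (1 / 2 - 3 / 2 / q) * I + 3 / 2 / q * (I - I / (2 * n + 2)) =
  I * (1 / 2 - 3 / 2 / (q * (2 * n + 2))).
  by field; rewrite !gt_eqF//; nra.
apply: ler_wpM2l => //.
have : 3 / 2 / (q * (2 * n + 2)) <= 1 / 4.
  by rewrite ler_pdivrMr; nra.
lra.
Qed.

(** The least [N] that beats the tail, of order [48 / h ^+ 2], still leaves an
integral of order [1 / sqrt N], that is of order [h].  It depends on [h] only,
which allows one exponent to serve all centres [s]. *)
Lemma exists_concentration h : 0 < h <= 1 / 4 -> exists N, forall F s,
  continuous F -> periodic F (2 * pi) ->
  (forall t, -1 <= F t) -> (forall t, `|t - s| <= h -> 1 / 2 <= F t) ->
  2 * pi * (h / 56) <= integral2pi (fun t => havercos (t - s) ^+ N * F t).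
Proof.
move=> /andP[h0 h14].
have h2 : 0 < h ^+ 2 by rewrite exprn_gt0.
have := @Num.Theory.truncn_itv R (48 / h ^+ 2) ltac:(by rewrite divr_ge0// ltW).
set n := Num.truncn _ => /andP[ln gn].
exists n.+1 => F s Fc Fper F1 Fh.
have N48 : 48 <= n.+1%:R * h ^+ 2 by rewrite -ler_pdivrMr// ltW.
have h01 : 0 < h <= 1 by rewrite h0/=; lra.
apply: le_trans (integral2pi_concentration h01 N48 Fc Fper F1 Fh).
have {}ln : n%:R * h ^+ 2 <= 48 by rewrite -ler_pdivlMr.
have := integral2pi_havercos_ge0 s n.+1; have := integral2pi_havercos_ge s n.+1.
move: (integral2pi _) => I I1 I0.
(* With [h <= 1/4], [(4 N + 1) h^2 <= 4 * 48 + 5 h^2 <= 14^2]. *)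
suff : 2 * pi * h <= 14 * I by lra.
rewrite -ler_sqr ?nnegrE ?mulr_ge0 ?pi_ge0 ?(ltW h0)//.
rewrite [leLHS]exprMn [leRHS]exprMn.
apply: le_trans (ler_wpM2r (ltW h2) I1) _.
rewrite mulrAC; apply: ler_wpM2r; first exact: sqr_ge0.
rewrite -natr1; nra.
Qed.

End concentration.

(** * The action of the kernel on moduli of Fourier coefficients *)

Section smoothing.
Context {R : realType}.
Implicit Types (s t th p : R) (g : R -> R) (k : int) (b : int -> R) (N : nat).

(** Convolution with the moduli [1/4, 1/2, 1/4] of the Fourier coefficients of
[havercos (t - s)], which do not depend on [s]. *)
Definition smooth b k : R := b k / 2 + b (k - 1) / 4 + b (k + 1) / 4.

Lemma smooth_ge0 b : (forall k, 0 <= b k) -> forall k, 0 <= smooth b k.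
Proof. by move=> b0 k; rewrite /smooth !addr_ge0// divr_ge0. Qed.

Lemma iter_smooth_ge0 b N :
  (forall k, 0 <= b k) -> forall k, 0 <= iter N smooth b k.
Proof. by move=> b0; elim: N => //= N IH; exact: smooth_ge0. Qed.

Lemma powR_midpoint p x y : 1 <= p -> 0 <= x -> 0 <= y ->
  ((x + y) / 2) `^ p <= (x `^ p + y `^ p) / 2.
Proof.
move=> p1 x0 y0.
have i0 : 0 <= 2^-1 :> R by rewrite invr_ge0.
have i1 : 2^-1 <= 1 :> R by rewrite invf_le1 ?ler1n.
have := @convex_powR R p p1 (Itv01 i0 i1) x y.
rewrite !inE/= !in_itv/= !andbT => /(_ x0 y0).
have E : (conv (Itv01 i0 i1) (x : R^o) (y : R^o) : R) = (x + y) / 2.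
  by rewrite convRE/= /unstable.onem; lra.
move=> H; rewrite -E; apply: (le_trans H).
by rewrite convRE/= /unstable.onem; lra.
Qed.

(** Jensen's inequality for the weights [1/4, 1/2, 1/4], obtained from the
midpoint inequality by grouping them as two midpoints. *)
Lemma powR_smooth p b k : 1 <= p -> (forall k, 0 <= b k) ->
  smooth b k `^ p <=
  b k `^ p / 4 + b k `^ p / 4 + (b (k - 1) `^ p / 4 + b (k + 1) `^ p / 4).
Proof.
move=> p1 b0.
have -> : smooth b k = ((b k + b (k - 1)) / 2 + (b k + b (k + 1)) / 2) / 2.
  by rewrite /smooth; field.
have bb0 l m : 0 <= (b l + b m) / 2 by rewrite divr_ge0// addr_ge0.
have := powR_midpoint p1 (bb0 k (k - 1)) (bb0 k (k + 1)).
have := powR_midpoint p1 (b0 k) (b0 (k - 1)).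
have := powR_midpoint p1 (b0 k) (b0 (k + 1)).
lra.
Qed.

Lemma esum_shift (a : int -> \bar R) (m : int) :
  (\esum_(k in [set: int]) a (k + m)%R = \esum_(k in [set: int]) a k)%E.
Proof.
have bij : set_bij [set: int] [set: int] (fun k => k + m)%R.
  rewrite setTT_bijective.
  by exists (fun k => k - m)%R => k; rewrite ?addrK ?subrK.
exact: esym (reindex_esum _ _ _ a bij).
Qed.

Lemma esum_smooth p b : 1 <= p -> (forall k, 0 <= b k) ->
  (\esum_(k in [set: int]) (smooth b k `^ p)%:E <=
   \esum_(k in [set: int]) (b k `^ p)%:E)%E.
Proof.
move=> p1 b0; pose q k := ((b k `^ p / 4)%:E : \bar R).
have q0 k : (0 <= q k)%E by rewrite lee_fin divr_ge0// powR_ge0.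
(* Quarters are summed separately: addition and translation of sums suffice,
   including when the sum is infinite. *)
have addq : \esum_(k in [set: int]) (b k `^ p)%:E =
    (\esum_(k in [set: int]) q k + \esum_(k in [set: int]) q k +
    (\esum_(k in [set: int]) q k + \esum_(k in [set: int]) q k))%E.
  rewrite -!esumD//; try by move=> *; rewrite adde_ge0.
  by apply: eq_esum => k _; rewrite /q -!EFinD; congr EFin; lra.
rewrite addq -{3}(esum_shift q (- 1)) -{3}(esum_shift q 1).
rewrite -!esumD//; try by move=> *; rewrite adde_ge0.
by apply: le_esum => k _; rewrite /q -!EFinD lee_fin powR_smooth.
Qed.

(** Smoothing averages translates of a sequence, so it is a contraction of
l^p. *)
Lemma esum_iter_smooth p b N : 1 <= p -> (forall k, 0 <= b k) ->
  (\esum_(k in [set: int]) (iter N smooth b k `^ p)%:E <=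
   \esum_(k in [set: int]) (b k `^ p)%:E)%E.
Proof.
move=> p1 b0; elim: N => //= N; apply: le_trans.
by apply: esum_smooth => //; exact: iter_smooth_ge0.
Qed.

Definition coef_modulus g k : R :=
  Normc.normc (fourier_coef (fun t => expi (g t)) k).

Lemma coef_modulus_ge0 g k : 0 <= coef_modulus g k.
Proof.
rewrite /coef_modulus /Normc.normc.
by case: (fourier_coef _ _) => a c; exact: sqrtr_ge0.
Qed.

(** The angle [th] selects a direction in the plane: the integral of
[cos (phase g k th)] is the real part of the unnormalised [k]-th coefficient of
[expi \o g] rotated by [- th].  A bound uniform in [th] is a bound on the
modulus, and only real integrals are involved. *)
Definition phase g k th t : R := g t - k%:~R * t - th.

Lemma continuous_phase g k th : continuous g -> continuous (phase g k th).
Proof.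
move=> gc; rewrite /phase.
have -> : (fun t => g t - k%:~R * t - th) =
    (fun t => g t + (- k%:~R * t + - th)).
  by apply/funext => t; ring.
apply: continuous_add => //; apply: continuous_add => [|t]; last exact: cvg_cst.
by apply: continuous_scale => t; exact: cvg_id.
Qed.

Lemma continuous_cos_phase g k th : continuous g ->
  continuous (fun t => cos (phase g k th t)).
Proof.
move=> gc t.
by apply: continuous_comp; [exact: continuous_phase|exact: continuous_cos].
Qed.

Lemma continuous_sin_phase g k th : continuous g ->
  continuous (fun t => sin (phase g k th t)).
Proof.
move=> gc t.
by apply: continuous_comp; [exact: continuous_phase|exact: continuous_sin].
Qed.

Lemma integral2pi_cos_phase g k th : continuous g ->
  integral2pi (fun t => cos (phase g k th t)) <= 2 * pi * coef_modulus g k.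
Proof.
move=> gc; have pi0 := pi_gt0 R.
have c0 : continuous (fun t => cos (phase g k 0 t)).
  exact: continuous_cos_phase.
have s0 : continuous (fun t => sin (phase g k 0 t)).
  exact: continuous_sin_phase.
set C := integral2pi (fun t => cos (phase g k 0 t)).
set S := integral2pi (fun t => sin (phase g k 0 t)).
have -> : integral2pi (fun t => cos (phase g k th t)) = cos th * C + sin th * S.
  rewrite -!integral2piZ// -integral2piD; try exact: continuous_scale.
  by congr integral2pi; apply/funext => t; rewrite /phase subr0 cosB; ring.
have -> : 2 * pi * coef_modulus g k = Num.sqrt (C ^+ 2 + S ^+ 2).
  rewrite /coef_modulus.
  have -> : fourier_coef (fun t => expi (g t)) k =
      ((2 * pi)^-1)%:C%C * (C +i* S)%C.
    rewrite /fourier_coef /period_integral; congr (_ * (_ +i* _)%C).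
      congr integral2pi; apply/funext => t.
      by rewrite /phase subr0 cosD/= cosN sinN; ring.
    congr integral2pi; apply/funext => t.
    by rewrite /phase subr0 sinD/= cosN sinN; ring.
  rewrite /= -{1}(gtr0_norm (pi2_gt0 : 0 < 2 * pi :> R)).
  rewrite -sqrtr_sqr -sqrtrM ?sqr_ge0//.
  congr Num.sqrt; move: C S (2 * pi) (@pi2_gt0 R) => c s P P0.
  by field; exact: lt0r_neq0.
(* Cauchy-Schwarz with the unit vector [(cos th, sin th)]. *)
apply: le_trans (ler_norm _) _; rewrite -sqrtr_sqr ler_wsqrtr//.
have := cos2Dsin2 th; have := sqr_ge0 (cos th * S - sin th * C).
move: (cos th) (sin th) => c s H E.
have -> : C ^+ 2 + S ^+ 2 = (c ^+ 2 + s ^+ 2) * (C ^+ 2 + S ^+ 2).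
  by rewrite E mul1r.
nra.
Qed.

(** The product-to-sum formula, in which translation by [s] only changes the
angles. *)
Lemma havercos_mul_cos_phase g k th s t :
  havercos (t - s) * cos (phase g k th t) =
  1 / 2 * cos (phase g k th t) + (1 / 4 * cos (phase g (k - 1) (th + s) t)
    + 1 / 4 * cos (phase g (k + 1) (th - s) t)).
Proof.
rewrite /havercos.
have -> : phase g (k - 1) (th + s) t = phase g k th t + (t - s).
  by rewrite /phase intrB; ring.
have -> : phase g (k + 1) (th - s) t = phase g k th t - (t - s).
  by rewrite /phase intrD; ring.
move: (phase g k th t) (t - s) => a u.
by rewrite cosD cosB; field.
Qed.

(** The right-hand side is free of [s] and [th], because the induction
hypothesis is applied with the modified angles [th + s] and [th - s]. *)
Lemma integral2pi_havercos_cos_phase g s N : continuous g -> forall k th,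
  integral2pi (fun t => havercos (t - s) ^+ N * cos (phase g k th t)) <=
  2 * pi * iter N smooth (coef_modulus g) k.
Proof.
move=> gc; elim: N => [|N IH] k th /=.
  under eq_fun do rewrite expr0 mul1r.
  exact: integral2pi_cos_phase.
pose f l a t := havercos (t - s) ^+ N * cos (phase g l a t).
have fc l a : continuous (f l a).
  by apply: continuous_mul;
    [exact: continuous_havercosX|exact: continuous_cos_phase].
have -> : (fun t => havercos (t - s) ^+ N.+1 * cos (phase g k th t)) =
  fun t => 1 / 2 * f k th t +
    (1 / 4 * f (k - 1) (th + s) t + 1 / 4 * f (k + 1) (th - s) t).
  apply/funext => t; rewrite exprSr -mulrA havercos_mul_cos_phase /f; ring.
rewrite !integral2piD ?integral2piZ//;
  do ?[apply: continuous_add|apply: continuous_scale]; rewrite //.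
rewrite /smooth.
have := IH k th; have := IH (k - 1) (th + s); have := IH (k + 1) (th - s).
rewrite -/(f _ _); move: (iter N _ _) => b; lra.
Qed.

End smoothing.

(** * Lower bound for the norm of a unimodular function *)

Section lower_bound.
Context {R : realType}.
Implicit Types (s t h p : R) (g : R -> R) (k m : int) (n : nat).

(** Where [g] is close to an affine function of slope [k], the angle
[g s - k * s] aligns the [k]-th coefficient with the positive axis, and
[cos (phase g k _ t) >= 1 / 2] on the interval of radius [h]. *)
Lemma exists_coef_lower_bound h : 0 < h <= 1 / 4 ->
  exists N, forall g k s, continuous g -> periodic g (2 * pi) ->
  (forall t, `|t - s| <= h -> `|g t - g s - k%:~R * (t - s)| <= 1 / 2) ->
  h / 56 <= iter N smooth (coef_modulus g) k.
Proof.
move=> h0; have [N HN] := exists_concentration h0; exists N => g k s gc gper gs.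
have := HN (fun t => cos (phase g k (g s - k%:~R * s) t)) s
  (continuous_cos_phase gc).
move=> lo; rewrite -(ler_pM2l (@pi2_gt0 R)).
apply: le_trans (integral2pi_havercos_cos_phase s N gc k (g s - k%:~R * s)).
apply: lo => [t|t|t ts].
- rewrite -[RHS](periodicz (_ : periodic (@cos R) (2 * pi)) (- k)); last first.
    by move=> x; rewrite mulr_natl cosD2pi.
  by rewrite /phase gper; congr cos; rewrite mulrNz -mulrzr; ring.
- exact: cos_geN1.
- have -> : phase g k (g s - k%:~R * s) t = g t - g s - k%:~R * (t - s).
    by rewrite /phase; ring.
  by apply: le_trans (cos_lip _); have := gs t ts; lra.
Qed.

Lemma esum_ge_run (a : int -> \bar R) m n (y : R) :
  (forall k, (0 <= a k)%E) ->
  (forall j, (j < n)%N -> (y%:E <= a (m + j%:Z)%R)%E) ->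
  ((n%:R * y)%:E <= \esum_(k in [set: int]) a k)%E.
Proof.
move=> a0 ya; apply: esum_ge.
exists [set (m + j%:Z)%R | j in `I_n].
  by split => //; apply: finite_image; exact: finite_II.
rewrite (reindex_fsbig (fun j : nat => (m + j%:Z)%R) `I_n)//; last first.
  by split => [j jn|i j _ _ /addrI[->]|k [j jn <-]]; try exists j.
rewrite -fsbig_ord.
have -> : (n%:R * y)%:E = (\sum_(j < n) y%:E)%E.
  by rewrite sumEFin sumr_const card_ord mulr_natl.
by apply: lee_sum => j _; exact: ya.
Qed.

(** All the frequencies are treated with the same smoothing exponent, which
depends on [h] only; each may have its own centre [s]. *)
Lemma Ap_norm_ge_run p g h m n : 1 <= p -> 0 < h <= 1 / 4 ->
  continuous g -> periodic g (2 * pi) ->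
  (forall j, (j < n)%N -> exists s, forall t, `|t - s| <= h ->
    `|g t - g s - (m + j%:Z)%:~R * (t - s)| <= 1 / 2) ->
  ((n%:R `^ p^-1 * (h / 56))%:E <= Ap_norm p (fun t => expi (g t)))%E.
Proof.
move=> p1 h0 gc gper loc; have [N HN] := exists_coef_lower_bound h0.
have p0 : 0 < p by lra.
have h56 : 0 <= h / 56 by case/andP: h0 => ? _; lra.
have -> : n%:R `^ p^-1 * (h / 56) = (n%:R * (h / 56) `^ p) `^ p^-1.
  by rewrite powRM ?powR_ge0// -powRrM mulfV ?gt_eqF// powRr1.
rewrite -poweR_EFin /Ap_norm; apply: gt0_ler_poweR.
- by rewrite invr_ge0 ltW.
- by rewrite in_itv/= leey lee_fin mulr_ge0// powR_ge0.
- by rewrite in_itv/= leey esum_ge0// => k _; rewrite lee_fin powR_ge0.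
apply: le_trans (esum_iter_smooth N p1 (coef_modulus_ge0 g)).
apply: esum_ge_run => [k|j jn]; first by rewrite lee_fin powR_ge0.
have [s gs] := loc _ jn.
rewrite lee_fin ge0_ler_powR ?nnegrE ?(ltW p0)//; last exact: HN gs.
by apply: iter_smooth_ge0; exact: coef_modulus_ge0.
Qed.

Lemma IVT_line (f : R -> R) x y v : continuous f -> f x <= v <= f y ->
  exists s, f s = v.
Proof.
move=> fc /andP[xv vy]; have [xy|/ltW yx] := leP x y.
  have [|s _ <-] := IVT xy (continuous_subspaceT fc) (_ : _ <= v <= _).
    by rewrite ge_min xv le_max vy orbT.
  by exists s.
have [|s _ <-] := IVT yx (continuous_subspaceT fc) (_ : _ <= v <= _).
  by rewrite ge_min xv le_max vy !orbT.
by exists s.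
Qed.

(** The frequencies are [floor (dg x) + j], [j <= dg y - dg x].  Each is within
[1] of the interval [[dg x, dg y]], hence of a value [dg s]; starting from the
floor guarantees at least one frequency even when the interval contains no
integer, so that small values of [dg y - dg x] need no separate argument. *)
Lemma Ap_norm_ge p g (dg : R -> R) h x y : 1 <= p -> 0 < h <= 1 / 4 ->
  periodic g (2 * pi) -> (forall t : R, is_derive t (1 : R) g (dg t)) ->
  continuous dg -> dg x <= dg y ->
  (forall t s, `|t - s| <= h -> `|dg t - dg s| * h <= 1 / 4) ->
  (((dg y - dg x) `^ p^-1 * (h / 56))%:E <= Ap_norm p (fun t => expi (g t)))%E.
Proof.
move=> p1 hh gper dgE dgc xy osc.
have /andP[h0 h4] := hh.
have gc : continuous g by apply: derivable_continuous => t; case: (dgE t).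
set D := dg y - dg x; have D0 : 0 <= D by rewrite subr_ge0.
have /andP[nD Dn] := Num.Theory.truncn_itv D0.
apply: (@le_trans _ _ (((Num.truncn D).+1%:R `^ p^-1 * (h / 56))%:E)).
  rewrite lee_fin ler_wpM2r ?divr_ge0 ?(ltW h0)// ge0_ler_powR ?nnegrE//.
    by rewrite invr_ge0; lra.
  exact: ltW.
apply: (@Ap_norm_ge_run _ _ _ (Num.floor (dg x))) => // j jn.
have := Num.Theory.floor_le (dg x); have := floorD1_gt (dg x).
rewrite intrD1 intrD -[j%:~R]/(j%:R); move: (Num.floor _)%:~R => m m1 m2.
have jD : j%:R <= D by apply: le_trans nD; rewrite ler_nat.
have j0 : 0 <= j%:R :> R by [].
have [s sE] : exists s, dg s = Num.max (dg x) (m + j%:R).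
  apply: (@IVT_line _ x y) => //; rewrite le_max lexx/= ge_max xy/=.
  by rewrite /D in jD; lra.
exists s => t ts.
have [z zts E] := mean_value s t dgE.
rewrite E -mulrBl normrM.
have zs : `|z - s| <= h.
  by move: zts ts; have [st|st] := leP s t; rewrite !ler_norml; lra.
have := osc _ _ zs.
have : `|dg z - (m + j%:R)| <= `|dg z - dg s| + 1.
  apply: le_trans (ler_distD (dg s) _ _) _; rewrite lerD2l sE ler_norml.
  by have [] := leP (dg x) (m + j%:R); lra.
have := normr_ge0 (t - s); have := normr_ge0 (dg z - (m + j%:R)).
have := normr_ge0 (dg z - dg s).
nra.
Qed.

End lower_bound.

(** * The modulus of continuity and the inverse of chi *)

Section modulus.
Context {R : realType}.
Implicit Types (omega g phi : R -> R) (t x y K d e : R).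

Lemma Lip_omega_bound omega g : (forall x, 0 <= x -> 0 <= omega x) ->
  Lip_omega omega setT g -> exists K d, [/\ 0 < K, 0 < d &
    forall e t1 t2, 0 < e < d -> `|t1 - t2| <= e ->
    `|g t1 - g t2| <= K * omega e].
Proof.
move=> w0 [C /nbhs_ballP[d /= d0 H]]; exists (`|C| + 1), d; split => //.
move=> e t1 t2 /andP[e0 ed] te.
have : ((`|g t1 - g t2|)%:E <= (C * omega e)%:E)%E.
  apply: le_trans (H e _ e0); last by rewrite /ball/= sub0r normrN gtr0_norm.
  by apply: ereal_sup_ubound; exists t1, t2.
rewrite lee_fin => /le_trans; apply; apply: ler_wpM2r; first exact/w0/ltW.
by have := ler_norm C; lra.
Qed.

Lemma bound_continuous omega g K d : 0 < K -> 0 < d ->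
  omega x @[x --> 0^'+] --> (0 : R) ->
  (forall e t1 t2, 0 < e < d -> `|t1 - t2| <= e ->
    `|g t1 - g t2| <= K * omega e) ->
  continuous g.
Proof.
move=> K0 d0 /cvgrPdist_le w0 gE t; apply/cvgrPdist_le => e e0.
have := w0 (e / K) (divr_gt0 e0 K0) => we.
have [x [x0 xd xw]] : exists x, [/\ 0 < x, x < d & K * omega x <= e].
  near (0 : R)^'+ => x; exists x; split.
  - by near: x; exact: nbhs_right_gt.
  - by near: x; exact: nbhs_right_lt.
  - have : `|0 - omega x| <= e / K by near: x.
    rewrite ler_pdivlMr// mulrC sub0r normrN.
    by have := ler_norm (omega x); nra.
near=> u; apply: le_trans xw; apply: gE; first by rewrite x0.
by apply/ltW; near: u; exact: cvgr_dist_lt.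
Unshelve. all: by end_near. Qed.

(** If [omega e = 0], then [g] takes equal values at points at distance at most
[e]; in particular [g] is [e]-periodic, and every point is [e]-close to a
translate of any other, so [g] is constant. *)
Lemma modulus_gt0 omega g K d : 0 < d ->
  {in `[0, +oo[ &, {homo omega : x y / x <= y}} -> omega 0 = 0 ->
  (forall e t1 t2, 0 < e < d -> `|t1 - t2| <= e ->
    `|g t1 - g t2| <= K * omega e) ->
  (exists t1 t2, g t1 <> g t2) -> forall x, 0 < x -> 0 < omega x.
Proof.
move=> d0 wmono w0 gE [t1 [t2 g12]] x x0; rewrite ltNge; apply/negP => wx.
pose e := Num.min x (d / 2).
have e0 : 0 < e by rewrite lt_min x0 divr_gt0.
have ex : e <= x by rewrite /e ge_min lexx.
have ed : e < d by rewrite /e gt_min; apply/orP; right; lra.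
have we : omega e = 0.
  apply: le_anti; rewrite (le_trans _ wx)/=; last first.
    by apply: wmono => //; rewrite in_itv/= andbT ltW.
  by rewrite -w0; apply: wmono; rewrite ?in_itv/= ?lexx ?andbT// ltW.
have loc u v : `|u - v| <= e -> g u = g v.
  move=> uv; apply/eqP; rewrite -subr_eq0 -normr_le0.
  by have := @gE e u v; rewrite we mulr0 e0 ed; exact.
have per : periodic g e.
  by move=> u; apply: loc; rewrite addrAC subrr add0r gtr0_norm.
have [n tn] := period_representative t2 t1 e0.
apply: g12; rewrite -(periodicz per n); apply: loc.
by apply: le_trans tn _; lra.
Qed.

Lemma derive1_nonconst phi : periodic phi (2 * pi) ->
  (forall t, derivable phi t 1) -> ~ (exists a, forall t, phi t = a) ->
  exists x y, phi^`()%classic x < phi^`()%classic y.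
Proof.
move=> per dphi nconst; apply: contrapT => dconst; apply: nconst.
pose a := phi^`()%classic 0.
have dphiE (t : R) : is_derive t (1 : R) phi a.
  have -> : a = 'D_1 phi t; last exact/derivableP/dphi.
  rewrite -derive1E; apply/eqP; rewrite eq_le !leNgt.
  apply/andP; split; apply/negP => lt; apply: dconst;
    by [exists t, 0|exists 0, t].
have [_ _] := mean_value 0 (2 * pi) dphiE.
have := per 0; rewrite add0r subr0 => ->; rewrite subrr => /esym/eqP.
rewrite mulf_eq0 (gt_eqF pi2_gt0) orbF => /eqP a0.
by exists (phi 0) => t; apply: is_derive_0_is_cst => z; rewrite -a0.
Qed.

(** The upper bound comes from [r * omega 1 <= r * omega r = y <= 1] when
[r >= 1].  It makes [chi_inv omega (1 / |lambda|)] bounded for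
[|lambda| >= 1], so that a constant multiple of it is an admissible radius. *)
Lemma chi_invP omega y : {within [set` `[0, +oo[], continuous omega} ->
  {in `[0, +oo[ &, {homo omega : x y / x <= y}} ->
  (forall x, 0 < x -> 0 < omega x) -> 0 < y <= 1 ->
  [/\ 0 < chi_inv omega y, chi_inv omega y <= 1 + 1 / omega 1
    & chi_inv omega y * omega (chi_inv omega y) = y].
Proof.
move=> wc wmono wpos /andP[y0 y1].
have w1 := wpos 1 ltr01; set M := 1 + 1 / omega 1.
have M1 : 1 <= M by rewrite lerDl divr_ge0// ltW.
have wM : omega 1 <= omega M.
  by apply: wmono; rewrite ?in_itv/= ?andbT//; lra.
have MwM : 1 <= M * omega M.
  apply: le_trans (_ : M * omega 1 <= _).
    by rewrite /M mulrDl divfK ?gt_eqF//; lra.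
  by rewrite ler_wpM2l//; lra.
have im : ((chi omega) @` [set` `[0, +oo[%R]) y.
  have [|||x xM xE] := @IVT R (chi omega) 0 M y.
  - lra.
  - apply: (@continuous_subspaceW _ _ [set` `[0%R, M]] [set` `[0%R, +oo[]).
      by move=> x /=; rewrite !in_itv/= => /andP[-> _].
    move=> x; apply: continuousM; last exact: wc.
    by apply: continuous_subspaceT => z; exact: cvg_id.
  - by rewrite /chi mul0r ge_min (ltW y0)/= le_max; apply/orP; right; lra.
  exists x => //=; move: xM; rewrite !in_itv/= => /andP[-> _]//.
have E : chi omega (chi_inv omega y) = y by apply: pinvK; rewrite inE.
have r0 : 0 <= chi_inv omega y.
  have surj : set_surj [set` `[0, +oo[%R] [set y] (chi omega) by move=> z /= ->.
  have /= := surjpinv_image_sub (dflt := fun=> 0) surj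
    (ex_intro2 _ _ y erefl erefl).
  by rewrite in_itv/= andbT.
have r1 : 0 < chi_inv omega y.
  rewrite lt_neqAle r0 andbT eq_sym; apply/eqP => r; move: E.
  by rewrite r /chi mul0r; lra.
split => //; rewrite leNgt; apply/negP => Mr.
have : omega M <= omega (chi_inv omega y).
  by apply: wmono; rewrite ?in_itv/= ?andbT//; lra.
by move: E; rewrite /chi; nra.
Qed.

End modulus.

(** * The lower bound for exponentials *)

Theorem theorem1 (R : realType) (p : R) (omega phi : R -> R)
    (p_ge1 : 1 <= p) (p_lt2 : p < 2)
    (omega_cont : {within [set` `[0, +oo[], continuous omega})
    (omega_nondecr : {in `[0, +oo[ &, {homo omega : x y / x <= y}})
    (omega0 : omega 0 = 0)
    (phi_nonconst : ~ exists a : R, forall t : R, phi t = a)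
    (phi_C1omega : C1omega_torus omega phi) :
  exists2 c : R, 0 < c &
    forall lambda : R, 1 <= `|lambda| ->
      ((c * `|lambda| `^ p^-1 * chi_inv omega (1 / `|lambda|))%:E
        <= Ap_norm p (fun t => expi (lambda * phi t)))%E.
Proof.
case: phi_C1omega => per [dphi lip].
have w_ge0 x : 0 <= x -> 0 <= omega x.
  by move=> x0; rewrite -omega0; apply: omega_nondecr => //;
    rewrite in_itv/= ?lexx ?x0.
have [K [d [K0 d0 dK]]] := Lip_omega_bound w_ge0 lip.
have w_cvg : omega x @[x --> 0^'+] --> (0 : R).
  by move/continuous_within_itvcyP: omega_cont => [_]; rewrite omega0; exact.
have dc := bound_continuous K0 d0 w_cvg dK.
have [x [y xy]] := derive1_nonconst per dphi phi_nonconst.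
have w_gt0 : forall x, 0 < x -> 0 < omega x.
  apply: (modulus_gt0 d0 omega_nondecr omega0 dK).
  by exists x, y => e; move: xy; rewrite e ltxx.
set M := 1 + 1 / omega 1.
have M1 : 1 <= M by rewrite lerDl divr_ge0// ltW// w_gt0.
(* Since [rho <= M], the radius [kappa * rho] stays in the range where the
   Lipschitz bound [K * omega] is valid, and both [kappa * rho] and
   [kappa * K] are at most [1 / 4]. *)
pose kappa := Num.min (d / 2) (1 / (4 * (K + 1))) / M.
have kappa0 : 0 < kappa.
  by rewrite divr_gt0 ?lt_min ?divr_gt0//=; lra.
have kM : kappa * M = Num.min (d / 2) (1 / (4 * (K + 1))).
  by rewrite divfK// gt_eqF//; lra.
have kMd : kappa * M < d by rewrite kM gt_min; apply/orP; left; lra.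
have kMK : kappa * M * (K + 1) <= 1 / 4.
  have : kappa * M <= 1 / (4 * (K + 1)) by rewrite kM ge_min lexx orbT.
  by rewrite ler_pdivlMr; lra.
have kM0 : 0 < kappa * M by rewrite mulr_gt0//; lra.
have kM4 : kappa * M <= 1 / 4 by nra.
have kK : kappa * K <= 1 / 4 by nra.
set D := phi^`()%classic y - phi^`()%classic x.
have D0 : 0 < D by rewrite subr_gt0.
exists (D `^ p^-1 * (kappa / 56)).
  by rewrite mulr_gt0 ?powR_gt0// divr_gt0.
move=> la la1.
have il : 0 < 1 / `|la| <= 1.
  by rewrite divr_gt0 ?ler_pdivrMr ?mul1r//; lra.
have [] := chi_invP omega_cont omega_nondecr w_gt0 il.
move: (chi_inv _ _) => r r0 rM rw.
have krM : kappa * r <= kappa * M by rewrite ler_wpM2l// ltW.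
have hh : 0 < kappa * r <= 1 / 4 by rewrite mulr_gt0//=; lra.
have gper : periodic (fun t => la * phi t) (2 * pi) by move=> t; rewrite per.
have dg (t : R) :
    is_derive t (1 : R) (fun t => la * phi t) (la * phi^`()%classic t).
  by rewrite derive1E; have := derivableP (dphi t) => H; apply: is_derive_eq.
have dgc : continuous (fun t => la * phi^`()%classic t).
  exact: continuous_scale.
have osc t s : `|t - s| <= kappa * r ->
    `|la * phi^`()%classic t - la * phi^`()%classic s| * (kappa * r) <= 1 / 4.
  move=> ts; rewrite -mulrBr normrM.
  have krd : 0 < kappa * r < d by rewrite mulr_gt0//=; lra.
  have kr : kappa * r <= r by nra.
  have wr : omega (kappa * r) <= omega r.
    by apply: omega_nondecr => //; rewrite in_itv/= andbT ltW// mulr_gt0.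
  have dw : `|phi^`()%classic t - phi^`()%classic s| <= K * omega r.
    by apply: le_trans (dK _ _ _ krd ts) _; rewrite ler_wpM2l// ltW.
  apply: le_trans (_ : `|la| * (K * omega r) * (kappa * r) <= _).
    by rewrite ler_wpM2r ?ler_wpM2l// mulr_ge0// ltW.
  have -> : `|la| * (K * omega r) * (kappa * r) =
    kappa * K * (`|la| * (r * omega r)) by ring.
  by rewrite rw div1r mulfV ?mulr1// gt_eqF//; lra.
(* The sign of [lambda] decides which of [x], [y] has the smaller slope. *)
have main u v : D * `|la| = la * phi^`()%classic v - la * phi^`()%classic u ->
    ((D `^ p^-1 * (kappa / 56) * `|la| `^ p^-1 * r)%:E
     <= Ap_norm p (fun t => expi (la * phi t)))%E.
  move=> E; apply: le_trans
    (Ap_norm_ge (x := u) (y := v) p_ge1 hh gper dg dgc _ osc); last first.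
    by rewrite -subr_ge0 -E mulr_ge0// ltW.
  rewrite /= -E powRM ?(ltW D0)// lee_fin le_eqVlt.
  by apply/orP; left; apply/eqP; ring.
have [la0|la0] := leP 0 la.
  by apply: (main x y); rewrite ger0_norm// /D; ring.
by apply: (main y x); rewrite ltr0_norm// /D; ring.
Qed.
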